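(* Let $R$ be a commutative integral domain, let $M$ be a torsionless $R$-module and let $\lambda$ be a cardinal. Then: (i) $\mathrm{G.dim}_R(M)=\mathrm{L.dim}_R(M)$. (ii) If $\lambda\ge\omega$, then $\mathrm{G.dim}_R(R^{\lambda})=|R^{\lambda}|$.
   Context: $R^{\lambda}$ is the direct product of $\lambda$ copies of $R$. An $R$-module $M$ is torsionless if the natural map $M\to M^{\ast\ast}$, $m\mapsto(g\mapsto g(m))$, is injective, where $M^{\ast}=\mathrm{Hom}_R(M,R)$. $\mathrm{G.dim}_R(M)$ (Goldie dimension) is the supremum of the set of cardinals $\kappa$ such that there is a family $(M_i)_{i\in\kappa}$ of non-zero $R$-modules with an injective $R$-linear map $\bigoplus_{i\in\kappa}M_i\to M$. $\mathrm{L.dim}_R(M)=\kappa$ (Lazarus dimension) means that the set of cardinalities of the maximal (with respect to inclusion) $R$-linearly independent subsets of $M$ is exactly $\{\kappa\}$. When $R$ is a domain, $\mathrm{L.dim}_R(M)$ exists for every $R$-module $M$. *)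

(* Defs.v *)
From HB Require Import structures.
From mathcomp Require Import all_boot all_order all_algebra.
From mathcomp Require Import all_classical.

Set Implicit Arguments.
Unset Strict Implicit.
Unset Printing Implicit Defensive.

Import GRing.Theory.
Local Open Scope classical_set_scope.
Local Open Scope ring_scope.
Local Open Scope card_scope.

Section DirectSum.
Context (R : pzRingType) (I : Type) (N : I -> lmodType R).

(* Named, because a module structure on [forall i, N i] itself would compete
   with the library's one on the non-dependent [I -> V]. *)
Definition dprod := forall i, N i.

HB.instance Definition _ := Choice.on dprod.

Definition dprod_add (f g : dprod) : dprod := fun i => f i + g i.
Definition dprod_zero : dprod := fun=> 0.
Definition dprod_opp (f : dprod) : dprod := fun i => - f i.
Definition dprod_scale (a : R) (f : dprod) : dprod := fun i => a *: f i.

Fact dprod_ext (f g : dprod) : (forall i, f i = g i) -> f = g.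
Proof. exact: functional_extensionality_dep. Qed.

Fact dprod_addA : associative dprod_add.
Proof. by move=> f g h; apply: dprod_ext => i; exact: addrA. Qed.
Fact dprod_addC : commutative dprod_add.
Proof. by move=> f g; apply: dprod_ext => i; exact: addrC. Qed.
Fact dprod_add0 : left_id dprod_zero dprod_add.
Proof. by move=> f; apply: dprod_ext => i; exact: add0r. Qed.
Fact dprod_addN : left_inverse dprod_zero dprod_opp dprod_add.
Proof. by move=> f; apply: dprod_ext => i; exact: addNr. Qed.

HB.instance Definition _ :=
  GRing.isZmodule.Build dprod dprod_addA dprod_addC dprod_add0 dprod_addN.

Fact dprod_scaleA a b f :
  dprod_scale a (dprod_scale b f) = dprod_scale (a * b) f.
Proof. by apply: dprod_ext => i; exact: scalerA. Qed.
Fact dprod_scale1 : left_id 1 dprod_scale.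
Proof. by move=> f; apply: dprod_ext => i; exact: scale1r. Qed.
Fact dprod_scaleDr : right_distributive dprod_scale +%R.
Proof. by move=> a f g; apply: dprod_ext => i; exact: scalerDr. Qed.
Fact dprod_scaleDl f : {morph dprod_scale^~ f : a b / a + b}.
Proof. by move=> a b; apply: dprod_ext => i; exact: scalerDl. Qed.

HB.instance Definition _ := GRing.Zmodule_isLmodule.Build R dprod
  dprod_scaleA dprod_scale1 dprod_scaleDr dprod_scaleDl.

Definition finsupp : pred dprod := fun f => `[< finite_set [set i | f i != 0] >].

Record dsum := DSum { dsum_val : dprod; _ : finsupp dsum_val }.

HB.instance Definition _ := [isSub for dsum_val].
HB.instance Definition _ := [Choice of dsum by <:].

Fact finsupp_submod : subsemimod_closed finsupp.
Proof.
split; [split|].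
- apply/asboolP; rewrite (_ : [set _ | _] = set0); first exact: finite_set0.
  by apply/seteqP; split=> // i /=; rewrite eqxx.
- move=> f g /asboolP finf /asboolP fing; apply/asboolP.
  apply: (@sub_finite_set _ _ ([set i | f i != 0] `|` [set i | g i != 0])).
    move=> i /= /eqP fgi; apply: contrapT.
    move=> /not_orP[/negP/negPn/eqP fi /negP/negPn/eqP gi].
    by apply: fgi; rewrite /GRing.add/= /dprod_add fi gi addr0.
  by rewrite finite_setU.
- move=> a f /asboolP finf; apply/asboolP.
  apply: (sub_finite_set _ finf) => i /= /eqP afi; apply/eqP => fi.
  by apply: afi; rewrite /GRing.scale/= /dprod_scale fi scaler0.
Qed.

HB.instance Definition _ :=
  GRing.SubChoice_isSubLmodule.Build R dprod finsupp dsum finsupp_submod.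

End DirectSum.

Section Dual.
Context (R : comPzRingType) (M : lmodType R).

Definition dual := {linear M -> R^o}.

HB.instance Definition _ := gen_eqMixin dual.
HB.instance Definition _ := gen_choiceMixin dual.

Definition dual_add (f g : dual) : dual := f \+ g.
Definition dual_zero : dual := \0.
Definition dual_opp (f : dual) : dual := \- f.
Definition dual_scale (a : R) (f : dual) : dual := a \*: f.

Fact dual_ext (f g : dual) : f =1 g -> f = g.
Proof.
case: f g => [f [[af] [sf]]] [g [[ag] [sg]]] /= /funext fg.
by subst g; congr (GRing.Linear.Pack (GRing.Linear.Class _ _)); congr (_ _);
  exact: Prop_irrelevance.
Qed.

Fact dual_addA : associative dual_add.
Proof. by move=> f g h; apply: dual_ext => x; exact: addrA. Qed.
Fact dual_addC : commutative dual_add.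
Proof. by move=> f g; apply: dual_ext => x; exact: addrC. Qed.
Fact dual_add0 : left_id dual_zero dual_add.
Proof. by move=> f; apply: dual_ext => x; exact: add0r. Qed.
Fact dual_addN : left_inverse dual_zero dual_opp dual_add.
Proof. by move=> f; apply: dual_ext => x; exact: addNr. Qed.

HB.instance Definition _ :=
  GRing.isZmodule.Build dual dual_addA dual_addC dual_add0 dual_addN.

Fact dual_scaleA a b f : dual_scale a (dual_scale b f) = dual_scale (a * b) f.
Proof. by apply: dual_ext => x; exact: mulrA. Qed.
Fact dual_scale1 : left_id 1 dual_scale.
Proof. by move=> f; apply: dual_ext => x; exact: mul1r. Qed.
Fact dual_scaleDr : right_distributive dual_scale +%R.
Proof. by move=> a f g; apply: dual_ext => x; exact: mulrDr. Qed.
Fact dual_scaleDl f : {morph dual_scale^~ f : a b / a + b}.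
Proof. by move=> a b; apply: dual_ext => x; exact: mulrDl. Qed.

HB.instance Definition _ := GRing.Zmodule_isLmodule.Build R dual
  dual_scaleA dual_scale1 dual_scaleDr dual_scaleDl.

End Dual.

Section Torsionless.
Context (R : comPzRingType) (M : lmodType R).

Definition eval_at (m : M) : dual M -> R^o := fun g => g m.

Fact eval_at_linear (m : M) : linear (eval_at m).
Proof. by []. Qed.

HB.instance Definition _ (m : M) :=
  GRing.isLinear.Build R (dual M) R^o *:%R (eval_at m) (eval_at_linear m).

Definition bidual_map (m : M) : dual (dual M) := eval_at m.

Definition torsionless : Prop := injective bidual_map.

End Torsionless.

(* Cardinals are represented by types, compared with [#<=] and [#=]; thus
   [has_Gdim M K] and [has_Ldim M K] say that the dimension exists and is the
   cardinality of [K], which determines [K] up to bijection. *)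

Section Goldie.
Context (R : pzRingType) (M : lmodType R).

Definition embeds_dsum (I : Type) : Prop :=
  exists (N : I -> lmodType R) (f : {linear dsum N -> M}),
    (forall i, exists x : N i, x != 0) /\ injective f.

Definition has_Gdim (K : Type) : Prop :=
  (forall I : Type, embeds_dsum I -> [set: I] #<= [set: K]) /\
  (forall L : Type, (forall I : Type, embeds_dsum I -> [set: I] #<= [set: L]) ->
    [set: K] #<= [set: L]).

End Goldie.

Section Lazarus.
Context (R : pzRingType) (M : lmodType R).

Definition lin_indep (A : set M) : Prop :=
  forall (s : seq M) (c : M -> R), uniq s -> [set` s] `<=` A ->
    \sum_(x <- s) c x *: x = 0 -> forall x, x \in s -> c x = 0.

Definition max_lin_indep (A : set M) : Prop :=
  lin_indep A /\ forall B : set M, A `<=` B -> lin_indep B -> B = A.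

Definition has_Ldim (K : Type) : Prop :=
  (exists A : set M, max_lin_indep A /\ A #= [set: K]) /\
  (forall A : set M, max_lin_indep A -> A #= [set: K]).

End Lazarus.

(* Main.v *)
(* Over a domain a torsionless module is torsion-free, so linear independence
   behaves as in a vector space: every element has a nonzero multiple in the
   span of a maximal independent set [A], and an independent set [B] satisfies
   [B #<= A].  For finite [A] this is linear algebra over the fraction field;
   for infinite [A] each finite sequence of elements of [A] controls only
   finitely many elements of [B], and there are [|A|] such sequences.
   Independent sets are exchanged with embedded direct sums by picking a nonzero
   element in each summand, so [|A|] is both dimensions.

   For infinite [Lambda], the "geometric" functions [l |-> r ^+ j l], where [j]
   retracts [Lambda] onto [nat], are independent by a Vandermonde argument,
   whence [|R| <= |A|]; the unit vectors give [|nat| <= |A|].  Then [R^Lambda]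
   has cardinality [|A|], as an element [m] is determined by the coefficients
   in a relation [r *: m = \sum_x c_x *: x] over [A]. *)
From HB Require Import structures.
From mathcomp Require Import generic_quotient finmap.
Require Import Defs.
From mathcomp Require Import all_boot all_order all_algebra.
From mathcomp Require Import all_classical.
Import GRing.Theory.
Local Open Scope classical_set_scope.
Local Open Scope ring_scope.
Local Open Scope card_scope.

(** * Cardinal arithmetic: comparability, pairs and finite sequences *)

Definition inj_on {T U : Type} (A : set T) (f : T -> U) : Prop :=
  forall x y, A x -> A y -> f x = f y -> x = y.

(** By Zorn's lemma there is a maximal graph of a partial injection from [A] to [B]; if it missed
    both a point of [A] and a point of [B], that pair could be added. *)
Lemma inj_on_total T (a : T) (A B : set T) :
  (exists2 f : T -> T, forall x, A x -> B (f x) & inj_on A f) \/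
  (exists2 f : T -> T, forall x, B x -> A (f x) & inj_on B f).
Proof.
pose P (G : set (T * T)) := (forall p, G p -> A p.1 /\ B p.2) /\
  forall p q, G p -> G q -> (p.1 = q.1 <-> p.2 = q.2).
have [F FP Ftot|G [[GAB PG] maxG]] := @Zorn_bigcup _ P.
  split=> [p [C FC Cp]|p q [C FC Cp] [D FD Dq]]; first exact: (FP C FC).1.
  by have [/(_ _ Cp) Dp|/(_ _ Dq) Cq] := Ftot C D FC FD;
    [apply: (FP D FD).2|apply: (FP C FC).2].
have [/choice[f fG]|/existsNP[x /forallNP xG]] :=
    pselect (forall x, exists y, A x -> G (x, y)).
  left; exists f => [x /fG/GAB[]//|x y /fG Gx /fG Gy fxy].
  exact/(PG _ _ Gx Gy).
have [/choice[f fG]|/existsNP[y /forallNP yG]] :=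
    pselect (forall y, exists x, B y -> G (x, y)).
  right; exists f => [y /fG/GAB[]//|y z /fG Gy /fG Gz fyz].
  exact/(PG _ _ Gy Gz).
have {xG}[Ax xG] : A x /\ forall y, ~ G (x, y).
  by split=> [|z]; [have /not_implyP[] := xG x|have /not_implyP[] := xG z].
have {yG}[By yG] : B y /\ forall x, ~ G (x, y).
  by split=> [|z]; [have /not_implyP[] := yG y|have /not_implyP[] := yG z].
case: (maxG (G `|` [set (x, y)])); first split.
- by move=> p; left.
- by move=> /(_ (x, y)) Gxy; apply: (xG y); apply: Gxy; right.
split=> [p [/GAB//|->//]|[p1 p2] [q1 q2] [Gp|[-> ->]] [Gq|[-> ->]]]//=.
- exact: (PG _ _ Gp Gq).
- by split=> e; [case: (xG p2)|case: (yG p1)]; rewrite -e.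
- by split=> e; [case: (xG q2)|case: (yG q1)]; rewrite e.
Qed.

(* Hessenberg's theorem by Zorn's lemma on the pairs of a set [D] and an
   injection [D * D -> D]: if [D] is maximal then its complement injects into
   [D], since otherwise [D] has a disjoint copy [E] in the complement, and the
   three new blocks of [(D `|` E) * (D `|` E)] can be sent into [E]. *)
Lemma inj_square (T : choiceType) (i : nat -> T) : injective i ->
  exists f : T * T -> T, injective f.
Proof.
move=> i_inj; pose a := i 0%N; pose b := i 1%N.
have ab : a <> b by move/i_inj.
pose good (p : set T * (T * T -> T)) :=
  [/\ p.1 a, p.1 b, forall x y, p.1 x -> p.1 y -> p.1 (p.2 (x, y)) &
      inj_on (p.1 `*` p.1) p.2].
pose j x := xget 0%N [set n | i n = x].
have ji n : j (i n) = n.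
  by rewrite /j; case: xgetP => [m _ /i_inj//|/(_ n) []].
have good0 : good (range i, fun p => i (pickle (j p.1, j p.2))).
  split=> /=; [by exists 0%N|by exists 1%N|by move=> x y _ _; eexists|].
  move=> [x1 x2] [y1 y2] /= [[m1 _ <-] [m2 _ <-]] [[n1 _ <-] [n2 _ <-]].
  by rewrite !ji => /i_inj/(pcan_inj pickleK)[-> ->].
(* Functions are arbitrary off the square of their set, so [R] is only a preorder. *)
pose R (s t : {p | good p}) := `[< (sval s).1 `<=` (sval t).1 /\
  forall x y, (sval s).1 x -> (sval s).1 y ->
    (sval s).2 (x, y) = (sval t).2 (x, y) >].
have Rxx t : R t t by apply/asboolP; split.
have [//| |C Ctot|[[D f] /= goodD] maxD] := @ZL_preorder _ (exist _ _ good0) R.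
- move=> r s t /asboolP[rs ers] /asboolP[st est]; apply/asboolP; split.
    exact: subset_trans rs st.
  by move=> x y rx ry; rewrite ers// est//; exact: rs.
- have [[s0 Cs0]|/forallNP C0] := pselect (exists s, C s); last first.
    by exists (exist _ _ good0) => s /C0.
  pose D := \bigcup_(s in C) (sval s).1.
  pose f p := xget a [set z | exists s, [/\ C s, (sval s).1 p.1,
    (sval s).1 p.2 & z = (sval s).2 p]].
  have fE s x y : C s -> (sval s).1 x -> (sval s).1 y ->
      f (x, y) = (sval s).2 (x, y).
    move=> Cs sx sy; rewrite /f; case: xgetP => [z _|]; last first.
      by move=> /(_ ((sval s).2 (x, y))) []; exists s.
    move=> [t [Ct /= tx ty ->]].
    by case: (Ctot s t Cs Ct) => /asboolP[_ ->].
  have D2 x y : D x -> D y -> exists s, [/\ C s, (sval s).1 x & (sval s).1 y].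
    move=> [s Cs sx] [t Ct ty].
    case: (Ctot s t Cs Ct) => /asboolP[st _].
      by exists t; split=> //; apply: st.
    by exists s; split=> //; apply: st.
  have goodU : good (D, f).
    split=> /=.
    - by exists s0 => //; case: (svalP s0).
    - by exists s0 => //; case: (svalP s0).
    - move=> x y Dx Dy; have [s [Cs sx sy]] := D2 x y Dx Dy.
      by exists s => //; rewrite (fE s)//; case: (svalP s) => _ _ + _; exact.
    - move=> [x1 x2] [y1 y2] /= [/= Dx1 Dx2] [/= Dy1 Dy2].
      have [s [Cs sx1 sx2]] := D2 _ _ Dx1 Dx2.
      have [t [Ct ty1 ty2]] := D2 _ _ Dy1 Dy2.
      by case: (Ctot s t Cs Ct) => /asboolP[st _];
        [rewrite !(fE t)//; try exact: st|rewrite !(fE s)//; try exact: st];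
        [case: (svalP t)|case: (svalP s)] => _ _ _;
        apply; split=> //; apply: st.
  exists (exist _ _ goodU) => s Cs; apply/asboolP; split=> /=.
    by move=> x sx; exists s.
  by move=> x y sx sy; rewrite (fE s).
have [/= Da Db Df f_inj] := goodD.
have f_inj2 x y x' y' : D x -> D y -> D x' -> D y' ->
    f (x, y) = f (x', y') -> x = x' /\ y = y'.
  move=> Dx Dy Dx' Dy'.
  by move=> /(f_inj (x, y) (x', y') (conj Dx Dy) (conj Dx' Dy'))[].
have [[g gD g_inj]|[g gD g_inj]] := inj_on_total _ a D (~` D); last first.
  (* [T] embeds into [D]: the tags [a] and [b] keep the images of [D] and of its complement
     apart. *)
  pose h x := if `[< D x >] then f (a, x) else f (b, g x).
  have Dh x : D (h x).
    by rewrite /h; case: asboolP => Dx; apply: Df => //; exact: gD.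
  have h_inj : injective h.
    move=> x y; rewrite /h; case: asboolP => Dx; case: asboolP => Dy.
    - by move=> /f_inj2[].
    - by move=> /f_inj2[]//; exact: gD.
    - by move=> /f_inj2[]//; [exact: gD|move=> /esym].
    - by move=> /f_inj2[]//; [exact: gD..|move=> _; exact: g_inj].
  exists (fun p => f (h p.1, h p.2)) => -[x1 x2] [y1 y2] /=.
  by move=> /f_inj2[]// /h_inj-> /h_inj->.
pose E := g @` D; pose D' := D `|` E.
(* A point of [D'] is coded by its representative [q] in [D] and a tag [c] telling [D] from [E]. *)
pose q x := if `[< D x >] then x else xget a [set y | D y /\ g y = x].
pose c x := if `[< D x >] then a else b.
pose z x y := f (f (c x, c y), f (q x, q y)).
pose f' p := if `[< D p.1 /\ D p.2 >] then f p else g (z p.1 p.2).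
have Dc x : D (c x) by rewrite /c; case: asboolP.
have Dq x : D' x -> D (q x).
  move=> D'x; rewrite /q; case: asboolP => // nDx.
  case: D'x => // -[y Dy gy]; case: xgetP => [? _ []//|].
  by move=> /(_ y) [].
have cq_inj x y : D' x -> D' y -> c x = c y -> q x = q y -> x = y.
  move=> D'x D'y; rewrite /c /q; case: asboolP => Dx; case: asboolP => Dy//.
    by move/esym.
  move=> _; case: D'x => // -[u Du gu]; case: D'y => // -[v Dv gv].
  case: xgetP => [u' _ [Du' gu']|/(_ u) []//].
  case: xgetP => [v' _ [Dv' gv']|/(_ v) []//].
  by move=> uv; rewrite -gu' -gv' uv.
have Dz x y : D' x -> D' y -> D (z x y).
  by move=> /Dq Dx /Dq Dy; apply: (Df); apply: (Df).
have z_inj x y x' y' : D' x -> D' y -> D' x' -> D' y' -> z x y = z x' y' ->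
    (x, y) = (x', y').
  move=> Dx Dy Dx' Dy' /f_inj2 e; case: e; do ?[by apply: Df => //; exact: Dq].
  move=> /f_inj2 e; case: e => // cx cy /f_inj2 e; case: e; do ?exact: Dq.
  by move=> qx qy; congr pair; exact: cq_inj.
have good' : good (D', f').
  split=> /=; [by left|by left| |].
    move=> x y D'x D'y; rewrite /f' /=; case: asboolP => [[Dx Dy]|_].
      by left; exact: Df.
    by right; exists (z x y) => //; exact: Dz.
  move=> [x1 x2] [y1 y2] /= [/= Dx1 Dx2] [/= Dy1 Dy2]; rewrite /f' /=.
  case: asboolP => [[? ?]|_]; case: asboolP => [[? ?]|_].
  - exact: f_inj.
  - by move=> e; case: (gD (z y1 y2)); [exact: Dz|rewrite -e; exact: Df].
  - by move=> e; case: (gD (z x1 x2)); [exact: Dz|rewrite e; exact: Df].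
  - by move=> /g_inj e; apply: z_inj => //; apply: e; exact: Dz.
(* [g a] lies outside [D], yet maximality forces [D'], which contains it, into [D]. *)
case: (gD a Da).
have /asboolP[+ _] : R (exist _ _ good') (exist _ (D, f) goodD).
  apply: maxD; apply/asboolP; split=> /= [x Dx|x y Dx Dy]; first by left.
  by rewrite /f' /=; case: asboolP => // -[].
by apply=> /=; right; exists a.
Qed.

(** Iterated pairing separates sequences of equal length; recording the length as well separates all
    of them. *)
Lemma inj_seq (T : choiceType) (i : nat -> T) : injective i ->
  exists f : seq T -> T, injective f.
Proof.
move=> i_inj; have [f f_inj] := inj_square _ _ i_inj.
pose h := foldr (fun x y => f (x, y)) (i 0).
have h_inj s t : size s = size t -> h s = h t -> s = t.
  elim: s t => [[]//|x s IHs [//|y t] /= [st]] /f_inj[-> /IHs->//].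
exists (fun s => f (i (size s), h s)) => s t /f_inj[/i_inj st /h_inj].
exact.
Qed.

Lemma card_leTP (T U : Type) :
  [set: T] #<= [set: U] <-> exists f : T -> U, injective f.
Proof.
split=> [/card_leP[f]|[f f_inj]].
  pose g (x : T) : U := val (f (SigSub (mem_set (I : [set: T] x)))).
  by exists g => x y /val_inj/inj e; case: (e (mem_set I) (mem_set I)).
have [g] : $|{injfun [set: T] >-> [set: U]}|.
  by apply/injfunPex; exists f => // x y _ _; exact: f_inj.
exact: inj_card_le.
Qed.

Lemma card_le_range {T U : Type} (f : T -> U) :
  injective f -> [set: T] #<= range f.
Proof.
move=> f_inj; rewrite (card_le_eqr (inj_card_eq _)) ?card_lexx//.
exact: in2W.
Qed.

(** * Linear algebra over a domain through its fraction field *)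

Lemma tofrac_surj (R : idomainType) (x : {fraction R}) :
  exists p : R * R, p.2 != 0 /\ x * tofrac p.2 = tofrac p.1.
Proof.
elim/quotW: x => q; exists (\n_q, \d_q); split; first exact: denom_ratioP.
rewrite /=; unlock FracField.tofrac; rewrite -[LHS]FracField.pi_mul.
apply/eqmodP => /=; rewrite /FracField.mulf FracField.equivfE.
rewrite !numden_Ratio ?mulf_neq0 ?oner_eq0 ?denom_ratioP//.
by rewrite !mulr1 mulrC.
Qed.

(** Counting ranks gives a kernel vector over the fraction field; a common denominator brings it
    back to [R]. *)
Lemma left_kernel_exists (R : idomainType) (n k : nat) (C : 'M[R]_(n, k)) :
  (k < n)%N -> exists2 u : 'rV[R]_n, u != 0 & u *m C = 0.
Proof.
move=> kn; pose F := {fraction R}.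
pose K := kermx (map_mx (@tofrac R) C).
have K0 : K != 0.
  rewrite -mxrank_eq0 mxrank_ker subn_eq0 -ltnNge.
  exact: leq_ltn_trans (rank_leq_col _) kn.
pose v := nz_row K.
have v0 : v != 0 by rewrite nz_row_eq0.
have vC : v *m map_mx (@tofrac R) C = 0.
  by apply/sub_kermxP; exact: nz_row_sub.
have /choice[p pP] : forall j, exists p : R * R,
  p.2 != 0 /\ v 0 j * tofrac p.2 = tofrac p.1 by move=> j; exact: tofrac_surj.
pose d := \prod_j (p j).2.
have d0 : d != 0 by apply/prodf_neq0 => j _; case: (pP j).
(* Each numerator is multiplied by the denominators of the other entries, so that [u] is [d] times
   [v]. *)
pose u : 'rV[R]_n := \row_j ((p j).1 * \prod_(i | i != j) (p i).2).
have uE : map_mx (@tofrac R) u = tofrac d *: v.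
  apply/rowP => j; rewrite !mxE [in RHS]/d [in RHS](bigD1 j)//= !rmorphM/=.
  by rewrite -(pP j).2 [RHS]mulrC mulrA.
exists u.
  apply: contraNneq v0 => u0; move: uE; rewrite u0 map_mx0 => /esym/eqP.
  by rewrite scaler_eq0 tofrac_eq0 (negPf d0).
apply/matrixP => i j; rewrite [RHS]mxE; apply/eqP.
rewrite -tofrac_eq0; apply/eqP.
have : map_mx (@tofrac R) (u *m C) i j = 0.
  by rewrite map_mxM uE -scalemxAl vC scaler0 mxE.
by rewrite mxE.
Qed.

(** * Torsion-free modules *)

Definition torsion_free {R : idomainType} (M : lmodType R) : Prop :=
  forall (a : R) (m : M), a != 0 -> a *: m = 0 -> m = 0.

(** If [a *: m = 0] with [a] nonzero, every functional kills [m], so [m] and [0] have the same image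
    in the bidual. *)
Lemma torsionless_torsion_free {R : idomainType} (M : lmodType R) :
  torsionless M -> torsion_free M.
Proof.
move=> tM a m a0 am0; apply: tM; apply: dual_ext => g /=.
pose h : {linear M -> R^o} := g; change (h m = h 0); rewrite linear0; apply/eqP.
have /eqP : a * h m = 0.
  by rewrite -[LHS]/(a *: h m : R^o) -linearZ_LR am0 linear0.
by rewrite mulf_eq0 (negPf a0).
Qed.

Lemma fun_torsion_free (R : idomainType) (T : Type) :
  torsion_free (T -> R^o).
Proof.
move=> a f a0 af0; apply/funext => x; apply/eqP.
have /eqP : a * f x = 0 by rewrite -[LHS]/((a *: f) x) af0.
by rewrite mulf_eq0 (negPf a0).
Qed.

(** * Linear independence over a domain *)

Section Independence.
Context {R : idomainType} {M : lmodType R}.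

(** The nonzero factor [p.1] makes up for the absence of division in [R]; [s] may have repeated
    entries. *)
Definition depends_on {I : Type} (v : I -> M) (s : seq I) (m : M) : Prop :=
  exists p : R * (I -> R), p.1 != 0 /\ p.1 *: m = \sum_(x <- s) p.2 x *: v x.

(** If [t] were longer than [s], the coefficient matrix would have a nonzero left kernel vector;
    weighting the relations by it cancels their right sides and leaves a nontrivial relation on
    [t]. *)
Lemma lin_indep_size {I : Type} (v : I -> M) (s : seq I) (t : seq M) :
  uniq t -> lin_indep [set` t] -> {in t, forall m, depends_on v s m} ->
  (size t <= size s)%N.
Proof.
move=> ut indt dept; rewrite leqNgt; apply/negP => st.
have /choice[p pP] : forall m, exists p : R * (I -> R), m \in t ->
    p.1 != 0 /\ p.1 *: m = \sum_(x <- s) p.2 x *: v x.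
  move=> m; have [/dept[p pP]|] := boolP (m \in t); first by exists p.
  by exists (0, fun=> 0).
pose C : 'M[R]_(size t, size s) :=
  \matrix_(i, j) (p t`_i).2 (tnth (in_tuple s) j).
have [u u0 uC] := left_kernel_exists _ _ _ C st.
(* [U] reads [u] as a function on [M] by position in [t], with value 0 elsewhere. *)
pose U m := if insub (index m t) is Some i then u 0 i else 0.
have Ut (i : 'I_(size t)) : U t`_i = u 0 i.
  by rewrite /U index_uniq// insubT//= => h; congr (u 0 _); apply: val_inj.
have sum0 : \sum_(m <- t) (U m * (p m).1) *: m = 0.
  rewrite (big_nth 0) big_mkord.
  transitivity (\sum_(i < size t) \sum_(j < size s)
      (u 0 i * C i j) *: v (tnth (in_tuple s) j)).
    apply: eq_bigr => i _; rewrite -scalerA (pP _ (mem_nth 0 (ltn_ord i))).2 Ut.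
    rewrite big_tnth scaler_sumr; apply: eq_bigr => j _.
    by rewrite scalerA mxE.
  rewrite exchange_big big1// => j _; rewrite -scaler_suml.
  have /matrixP/(_ 0 j) := uC; rewrite !mxE => ->; exact: scale0r.
case/eqP: u0; apply/rowP => i; rewrite mxE; apply/eqP.
have ti := mem_nth 0 (ltn_ord i).
have /eqP := indt t (fun m => U m * (p m).1) ut (@subset_refl _ _) sum0 _ ti.
by rewrite mulf_eq0 (negPf (pP _ ti).1) orbF Ut.
Qed.

Lemma lin_indep_sub (A B : set M) :
  A `<=` B -> lin_indep B -> lin_indep A.
Proof. by move=> AB iB s c us sA; apply: iB => //; exact: subset_trans AB. Qed.

Lemma seq_range {I : Type} {T : choiceType} (v : I -> T) (s : seq T) :
  [set` s] `<=` range v -> exists t : seq I, s = map v t.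
Proof.
elim: s => [|x s IHs] sA; first by exists [::].
have [y sy|t ->] := IHs; first by apply: sA; rewrite /= inE sy orbT.
have [i _ <-] : range v x by apply: sA; rewrite /= mem_head.
by exists (i :: t).
Qed.

(** Adjoining a new [m] to [A] creates a nontrivial relation; [m] has a nonzero coefficient in it
    because [A] is independent, so it can be solved for that multiple of [m]. *)
Lemma max_lin_indep_depends (A : set M) (m : M) : max_lin_indep A ->
  exists s : seq A, depends_on val s m.
Proof.
move=> [iA maxA].
have [Am|Am] := pselect (A m).
  exists [:: SigSub (mem_set Am)], (1, fun=> 1); split; first exact: oner_neq0.
  by rewrite big_seq1.
have : ~ lin_indep (m |` A).
  by move=> /(maxA _ (@subsetUr _ _ _)) mA; apply: Am; rewrite -mA; left.
move=> /existsNP[s /existsNP[c /not_implyP[us /not_implyP[sA]]]].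
move=> /not_implyP[s0 /existsNP[x /not_implyP[xs /eqP cx]]].
have sA' y : y \in s -> y != m -> A y by move=> /sA[->|//]; rewrite eqxx.
have ms : m \in s.
  apply: contraT => ms; case/eqP: cx; apply: (iA s c us _ s0 x xs) => y ys.
  by apply: sA' => //; apply: contraNneq ms => <-.
have remA : [set` rem m s] `<=` A.
  by move=> y /=; rewrite mem_rem_uniq// inE => /andP[ym ys]; exact: sA'.
have cm : c m != 0.
  apply: contra_neq cx => cm; have [->//|xm] := eqVneq x m.
  apply: (iA (rem m s)) => //; first exact: rem_uniq.
    move: s0; rewrite (perm_big _ (perm_to_rem ms)) big_cons/=.
    by rewrite cm scale0r add0r.
  by rewrite mem_rem_uniq// inE xm.
have [t st] : exists t : seq A, rem m s = map val t.
  by apply: seq_range => y /remA Ay; exists (SigSub (mem_set Ay)).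
exists t, (c m, fun x => - c (val x)); split=> //=.
move/eqP: s0; rewrite (perm_big _ (perm_to_rem ms)) big_cons/= st big_map.
rewrite addr_eq0 => /eqP->; rewrite -sumrN.
by apply: eq_bigr => y _; rewrite scaleNr.
Qed.

(** Adding up the coefficients of indices with the same image turns an indexed relation into one
    over a duplicate-free list. *)
Lemma depends_on_id {I : Type} (v : I -> M) (s : seq I) (X : seq M) (m : M) :
  uniq X -> {subset map v s <= X} -> depends_on v s m -> depends_on id X m.
Proof.
move=> uX sX [[r c] [/= r0 rm]].
exists (r, fun y => \sum_(x <- s | v x == y) c x); split=> //=.
rewrite rm; under [RHS]eq_bigr do rewrite scaler_suml big_mkcond.
rewrite exchange_big/=; elim: s sX {rm} => [|x s IHs] sX.
  by rewrite !big_nil.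
rewrite !big_cons -IHs; last by move=> y ys; apply: sX; rewrite inE ys orbT.
congr (_ + _); rewrite (bigD1_seq (v x))//=; last first.
  by apply: sX; rewrite mem_head.
by rewrite eqxx big1 ?addr0// => y /negPf; rewrite eq_sym => ->.
Qed.

Lemma lin_indep_card_le (A B : set M) :
  max_lin_indep A -> lin_indep B -> B #<= A.
Proof.
move=> maxA iB.
have /choice[S SP] m := max_lin_indep_depends A m maxA.
(* Elements of [B] with the same sequence [s] all depend on [s], so there are at most [size s] of
   them. *)
have fin_fiber s : exists e : seq M, B `&` [set m | S m = s] = [set` e].
  apply/finite_seqP; apply: contrapT.
  move=> /(@infinite_set_fset M _ (size s).+1)[Y YB].
  rewrite ltnNge => /negP; apply.
  apply: (lin_indep_size (val : A -> M)); first exact: fset_uniq.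
    by apply: lin_indep_sub iB => y /YB[].
  by move=> y /YB[_ <-]; exact: SP.
have [finA|infA] := pselect (finite_set A).
  have [X AX] := iffLR (@finite_fsetP _ A) finA.
  (* [X] lists all of [A], so every element depends on this single list. *)
  have BX (Y : {fset M}) : [set` Y] `<=` B -> (#|` Y| <= #|` X|)%N.
    move=> YB; apply: (lin_indep_size id); first exact: fset_uniq.
      exact: lin_indep_sub iB.
    move=> m _; apply: depends_on_id (SP m); first exact: fset_uniq.
    move=> _ /mapP[x _ ->].
    have AX' z : A z -> z \in X by rewrite AX.
    by apply: AX'; exact: set_valP.
  have [/finite_fsetP[Y BY]|infB] := pselect (finite_set B); last first.
    have [Y /BX] := @infinite_set_fset M _ (#|` X|).+1 infB.
    by rewrite leqNgt => /negbTE->.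
  have cardE (Z : {fset M}) : [set` Z] #= `I_#|` Z| by exact/card_eq_fsetP.
  rewrite AX BY (card_le_eql (cardE Y)) (card_le_eqr (cardE X)) card_le_II.
  by rewrite BX// BY.
have /card_leTP[i i_inj] : [set: nat] #<= [set: A].
  by rewrite (card_le_eqr (card_setT A)); apply/infiniteP.
have [f f_inj] := inj_seq _ i i_inj.
have /choice[e eP] := fin_fiber.
rewrite -(card_le_eqr (card_setT A)) -(card_le_eql (card_setT B)).
(* [m] is coded by [S m] preceded by its position in the finite fibre, the position being carried
   into [A] by [i]. *)
apply/card_leTP; pose g m := f (i (index m (e (S m))) :: S m).
exists (fun m : B => g (val m)) => m n /f_inj[/i_inj + Smn].
have mem (k : B) : val k \in e (S (val k)).
  have : (B `&` [set m | S m = S (val k)]) (val k).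
    by split=> //; exact: set_valP.
  by rewrite eP.
move=> /(congr1 (nth 0 (e (S (val m))))); rewrite nth_index ?mem//.
rewrite Smn nth_index ?mem//.
exact: val_inj.
Qed.

End Independence.

(** Zorn's lemma applies because a relation involves finitely many elements, which lie in one member
    of a chain. *)
Lemma max_lin_indep_exists (R : idomainType) (M : lmodType R) :
  exists A : set M, max_lin_indep A.
Proof.
have [F Find Ftot|A [iA maxA]] := @Zorn_bigcup M (@lin_indep R M).
  move=> s c us sF s0 x xs.
  suff [X FX sX] : exists2 X, F X & [set` s] `<=` X.
    by exact: (Find X FX s c us sX s0 x xs).
  (* The entry [x] supplies the chain member needed for the empty list. *)
  have : exists X, F X by have [X FX _] := sF x xs; exists X.
  move=> [X0 FX0]; elim: s sF {us s0 xs} => [|y s IHs] sF; first by exists X0.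
  have [X FX sX] : exists2 X, F X & [set` s] `<=` X.
    by apply: IHs => z zs; apply: sF; rewrite /= inE zs orbT.
  have [Y FY Yy] : (\bigcup_(X in F) X) y by apply: sF; rewrite /= mem_head.
  have [XY|YX] := Ftot X Y FX FY.
    by exists Y => // z /=; rewrite inE => /orP[/eqP->//|/sX/XY].
  by exists X => // z /=; rewrite inE => /orP[/eqP->|/sX//]; exact: YX.
exists A; split=> // B AB iB; apply: contrapT => BA.
by apply: (maxA B) iB; rewrite properEneq; split=> //; apply/eqP => /esym/BA.
Qed.

(** * Embedded direct sums and independent sets *)

Section Goldie.
Context {R : idomainType} {M : lmodType R}.

(** The canonical map from the free module on [I]; the sum has finite support. *)
Definition lin_comb {I : choiceType} (v : I -> M)
    (g : dsum (fun _ : I => R^o)) : M :=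
  \sum_(i \in [set: I]) (dsum_val g i : R) *: v i.

Lemma dsum_val_finite {I : choiceType} (N : I -> lmodType R) (g : dsum N) :
  finite_set [set i | dsum_val g i != 0].
Proof. by case: g => g /= /asboolP. Qed.

Lemma lin_combE {I : choiceType} (v : I -> M) (g : dsum (fun _ : I => R^o))
    (s : {fset I}) : [set i | dsum_val g i != 0] `<=` [set` s] ->
  lin_comb v g = \sum_(i <- s) (dsum_val g i : R) *: v i.
Proof.
move=> gs; rewrite fsbig_seq ?fset_uniq//.
apply/esym/fsbig_widen => // i [_ /= si].
have [->|/gs//] := eqVneq (dsum_val g i) 0; exact: scale0r.
Qed.

Lemma lin_comb_linear {I : choiceType} (v : I -> M) : linear (lin_comb v).
Proof.
move=> a g h.
pose s := (fset_set [set i | dsum_val g i != 0] `|`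
  fset_set [set i | dsum_val h i != 0])%fset.
have [fg fh] := (dsum_val_finite _ g, dsum_val_finite _ h).
have gs : [set i | dsum_val g i != 0] `<=` [set` s].
  by move=> i gi; rewrite /= in_fsetU !in_fset_set// mem_set.
have hs : [set i | dsum_val h i != 0] `<=` [set` s].
  by move=> i hi; rewrite /= in_fsetU !in_fset_set// orbC mem_set.
rewrite !(lin_combE v _ s)//.
  rewrite scaler_sumr -big_split; apply: eq_bigr => i _ /=.
  by rewrite scalerA -scalerDl.
move=> i ghi; apply: contrapT => si; case/eqP: ghi.
rewrite -[LHS]/(a * dsum_val g i + dsum_val h i).
have -> : dsum_val g i = 0 by apply/eqP; apply: contra_notT si => /gs.
have -> : dsum_val h i = 0 by apply/eqP; apply: contra_notT si => /hs.
by rewrite mulr0 addr0.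
Qed.

HB.instance Definition _ (I : choiceType) (v : I -> M) :=
  GRing.isLinear.Build R (dsum (fun _ : I => R^o)) M *:%R (lin_comb v)
    (lin_comb_linear v).

(** Independence says that the canonical map from the free module on [A] has trivial kernel. *)
Lemma lin_indep_embeds (A : set M) : lin_indep A -> embeds_dsum M A.
Proof.
move=> iA.
exists (fun=> R^o), (lin_comb (val : A -> M)).
split=> [_|]; first by exists 1; exact: oner_neq0.
apply: raddf_inj => g g0; apply: val_inj; apply: dprod_ext => i.
pose s := fset_set [set i | dsum_val g i != 0].
apply: contrapT => /eqP gi.
have fing := dsum_val_finite _ g.
have sE : s =i [set i | dsum_val g i != 0] by exact: in_fset_set.
have is_ : i \in s by rewrite sE inE.
pose c m := if insub m is Some i then dsum_val g i else 0.
have cE (j : A) : c (val j) = dsum_val g j by rewrite /c valK.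
move/eqP: gi; apply; rewrite -[LHS]cE; apply: (iA (map val s)).
- by rewrite map_inj_uniq ?fset_uniq//; exact: val_inj.
- by move=> _ /mapP[j _ ->]; exact: set_valP.
- rewrite big_map; under eq_bigr do rewrite cE.
  by rewrite -lin_combE// => j gj; rewrite /= sE inE.
- exact: map_f.
Qed.

(** Taking the whole family [x] gives [x j] the type [N j] with no transport along [j = i]. *)
Definition dsum_single {I : Type} (N : I -> lmodType R) (x : forall i, N i)
    (i : I) : dprod N :=
  fun j => if `[< j = i >] then x j else 0.

Lemma dsum_single_finsupp {I : Type} (N : I -> lmodType R) (x : forall i, N i)
    (i : I) : finsupp (dsum_single N x i).
Proof.
apply/asboolP; apply: (sub_finite_set _ (finite_set1 i)) => j /=.
by rewrite /dsum_single; case: asboolP => // _; rewrite eqxx.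
Qed.

(** [B] consists of the images of nonzero elements chosen one per summand; injectivity of [f] lets a
    relation among them be read off component by component. *)
Lemma embeds_lin_indep (I : Type) : torsion_free M -> embeds_dsum M I ->
  exists2 B : set M, lin_indep B & [set: I] #<= B.
Proof.
move=> tfM; elim/Pchoice: I => I [N [f [N0 f_inj]]].
have x i := cid (N0 i).
pose d i : dsum N := DSum (dsum_single_finsupp N (fun j => sval (x j)) i).
have dii i : dsum_val (d i) i = sval (x i).
  by rewrite /= /dsum_single; case: asboolP.
have dij i j : i != j -> dsum_val (d i) j = 0.
  by rewrite /= /dsum_single; case: asboolP => // ->; rewrite eqxx.
have d0 i : d i != 0.
  by apply: contraNneq (svalP (x i)) => di0; rewrite -dii di0.
pose v i := f (d i).
have v_inj : injective v.
  move=> i j /f_inj dE; apply: contrapT => /eqP ij.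
  by have := svalP (x i); rewrite -dii dE dij ?eqxx// eq_sym.
exists (range v); last exact: card_le_range.
move=> s c us /seq_range[t st]; move: us; rewrite {s}st => /map_uniq ut.
rewrite big_map => s0 _ /mapP[i it ->].
have {s0} sd0 : \sum_(j <- t) c (v j) *: d j = 0.
  apply: f_inj; rewrite linear0 linear_sum -[RHS]s0.
  by apply: eq_bigr => j _; rewrite linearZ_LR.
have vE j : dsum_val (c (v j) *: d j) i = c (v j) *: dsum_val (d j) i by [].
have cx0 : c (v i) *: sval (x i) = 0.
  have := congr1 (fun g => dsum_val g i) sd0.
  rewrite (big_morph (fun g : dsum N => dsum_val g i)
    (id1 := 0) (op1 := +%R))//.
  rewrite (bigD1_seq i)// big1 => [|j ji]; last by rewrite vE dij// scaler0.
  by rewrite vE dii/= addr0.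
(* Torsion-freeness is known for [M], so the vanishing multiple of [d i] is moved there by [f]. *)
apply: contrapT => /eqP c0; move/eqP: (d0 i); apply.
apply: f_inj; rewrite linear0; apply: (tfM _ _ c0); rewrite -linearZ_LR.
rewrite -[RHS](linear0 f); congr (f _); apply: val_inj; apply: dprod_ext => j.
have [<-|ij] := eqVneq i j.
  by rewrite -[LHS]/(c (v i) *: dsum_val (d i) i) dii.
by rewrite -[LHS]/(c (v i) *: dsum_val (d i) j) dij// scaler0.
Qed.

(** [A] bounds every embedded index type and is itself one. *)
Lemma max_lin_indep_Gdim (A : set M) : torsion_free M -> max_lin_indep A ->
  has_Gdim M A.
Proof.
move=> tfM maxA; split=> [I /(embeds_lin_indep _ tfM)[B iB IB]|L ubL].
  apply: card_le_trans IB _.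
  by rewrite (card_le_eqr (card_setT A)); exact: lin_indep_card_le.
by apply/ubL/lin_indep_embeds; case: maxA.
Qed.

End Goldie.

Lemma has_Gdim_card_eq {R : idomainType} {M : lmodType R} (K L : Type) :
  [set: K] #= [set: L] -> has_Gdim M K -> has_Gdim M L.
Proof.
move=> KL [ub lub]; split=> [I /ub IK|P ubP].
  by rewrite -(card_le_eqr KL).
by rewrite -(card_le_eql KL); exact: lub.
Qed.

(** * Independent families in powers of the domain *)

Lemma lin_indep_geometric (R : idomainType) {T : Type} (e : nat -> T)
    (j : T -> nat) : cancel e j ->
  lin_indep (range (fun (r : R) (l : T) => r ^+ j l : R^o)).
Proof.
move=> ej; set x := fun r => _; move=> s c us /seq_range[t st].
move: us; rewrite {s}st => /map_uniq ut; rewrite big_map => s0 _ /mapP[r rt ->].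
have sum_pow n : \sum_(a <- t) c (x a) * a ^+ n = 0.
  have := congr1 (fun f => f (e n)) s0; rewrite fct_sumE => s0n.
  by rewrite -[RHS]s0n; apply: eq_bigr => a _; rewrite -{1}(ej n).
have sum_poly (p : {poly R}) : \sum_(a <- t) c (x a) * p.[a] = 0.
  under eq_bigr do rewrite horner_coef mulr_sumr.
  rewrite exchange_big big1// => i _.
  under eq_bigr do rewrite mulrCA.
  by rewrite -mulr_sumr sum_pow mulr0.
(* [p] vanishes on [t] except at [r], which isolates the coefficient of [r]. *)
pose p := \prod_(a <- t | a != r) ('X - a%:P).
have := sum_poly p; rewrite (bigD1_seq r)//= big1_seq ?addr0; last first.
  move=> a /andP[ar at_]; rewrite /p horner_prod big_mkcond (bigD1_seq a)//= ar.
  by rewrite hornerXsubC subrr mul0r mulr0.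
move=> /eqP; rewrite mulf_eq0 => /orP[/eqP//|].
rewrite /p horner_prod prodf_seq_eq0 => /hasP[a _ /andP[ar]].
by rewrite hornerXsubC subr_eq0 eq_sym (negPf ar).
Qed.

(** These are the indicators of the fibres of [j]; evaluation at [e n] isolates the coefficient of
    index [n]. *)
Lemma lin_indep_unit (R : idomainType) {T : Type} (e : nat -> T)
    (j : T -> nat) : cancel e j ->
  lin_indep (range (fun (n : nat) (l : T) => (j l == n)%:R : R^o)).
Proof.
move=> ej; set x := fun n => _; move=> s c us /seq_range[t st].
move: us; rewrite {s}st => /map_uniq ut; rewrite big_map => s0 _ /mapP[n nt ->].
have xE m : (c (x m) *: (x m : T -> R^o)) (e n) = c (x m) * (n == m)%:R.
  by rewrite -[LHS]/(c (x m) * (j (e n) == m)%:R) ej.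
have := congr1 (fun f => f (e n)) s0; rewrite fct_sumE (bigD1_seq n)// big1.
  by rewrite xE eqxx mulr1/= addr0.
by move=> m mn; rewrite xE eq_sym (negPf mn) mulr0.
Qed.

Lemma card_le_max_lin_indep (R : idomainType) (M : lmodType R) (A : set M) :
  torsion_free M -> max_lin_indep A -> [set: nat] #<= A -> [set: R] #<= A ->
  [set: M] #<= A.
Proof.
move=> tfM maxA; rewrite -!(card_le_eqr (card_setT A)).
move=> /card_leTP[i i_inj] /card_leTP[q q_inj]; apply/card_leTP.
have [f f_inj] := inj_square _ i i_inj; have [h h_inj] := inj_seq _ i i_inj.
have /choice[S /choice[p pP]] m := max_lin_indep_depends A m maxA.
(* A pair of an element of [A] and a coefficient becomes one element of [A], so a whole relation is
   a finite sequence in [A]. *)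
pose code m x := f (x, q ((p m).2 x)).
exists (fun m => f (q (p m).1, h (map (code m) (S m)))) => m n.
move=> /f_inj[/q_inj r_eq /h_inj codeE].
have [pm pn] := (pP m, pP n).
suff sum_eq : \sum_(x <- S m) (p m).2 x *: val x =
    \sum_(x <- S n) (p n).2 x *: val x.
  apply/eqP; rewrite -subr_eq0; apply/eqP; apply: (tfM _ _ pm.1).
  by rewrite scalerBr pm.2 r_eq pn.2 sum_eq subrr.
elim: (S m) (S n) codeE {pm pn} => [|x s IHs] [|y t]//=.
  by rewrite !big_nil.
by move=> [/f_inj[-> /q_inj c_eq] /IHs s_eq]; rewrite !big_cons c_eq s_eq.
Qed.

Theorem theorem5p11 (R : idomainType) (M : lmodType R) (hM : torsionless M)
    (Lambda : Type) :
  (exists K : Type, has_Gdim M K /\ has_Ldim M K) /\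
  ([set: nat] #<= [set: Lambda] ->
   has_Gdim ((Lambda -> R^o) : lmodType R) (Lambda -> R)).
Proof.
split=> [|/card_leTP[e e_inj]].
  have [A maxA] := max_lin_indep_exists R M.
  exists A; split.
    by apply: max_lin_indep_Gdim => //; exact: torsionless_torsion_free.
  have AT := card_setT A; split=> [|B maxB].
    by exists A; split=> //; rewrite card_esym.
  rewrite (card_eqr AT) card_eq_le; apply/andP.
  split; apply: lin_indep_card_le => //.
    by case: maxB.
  by case: maxA.
have [A maxA] := max_lin_indep_exists R (Lambda -> R^o).
have tfV := fun_torsion_free R Lambda.
(* [j] inverts [e] on its range and is 0 elsewhere. *)
have /choice[j je] l : exists n, forall m, e m = l -> m = n.
  have [[n en]|/forallNP en] := pselect (exists n, e n = l).
    by exists n => m; rewrite -en => /e_inj.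
  by exists 0%N => m /en.
have ej : cancel e j by move=> n; rewrite -(je _ n).
apply: has_Gdim_card_eq (max_lin_indep_Gdim A tfV maxA).
rewrite (card_eql (card_setT A)) card_eq_le card_leT /=.
apply: (card_le_max_lin_indep _ _ A tfV maxA).
  apply: card_le_trans (lin_indep_card_le A _ maxA (lin_indep_unit R e j ej)).
  apply: card_le_range => m n /(congr1 (fun f => f (e m))).
  by rewrite ej eqxx; case: eqP => // _ /eqP; rewrite oner_eq0.
apply: card_le_trans
  (lin_indep_card_le A _ maxA (lin_indep_geometric R e j ej)).
(* The value at [e 1] has exponent 1, hence recovers [r]. *)
apply: card_le_range => r r' /(congr1 (fun f => f (e 1%N))).
by rewrite ej !expr1.
Qed.
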